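(* Let $k\ge 2$ and let $w_1,\dots,w_k$ be strictly positive weights that sum to $1$. Then the linear combination formula $G(F_1,\dots,F_k)=\sum_{i=1}^k w_iF_i$ fails to be coherent relative to the class $\mathcal{F}_{\mathbb{R}}$ of all cumulative distribution functions on $\mathbb{R}$.
   Context: A prediction space is a probability space $(\Omega,\mathcal{A},\mathbb{Q})$ with sub-$\sigma$-algebras $\mathcal{A}_1,\dots,\mathcal{A}_k\subseteq\mathcal{A}$ carrying: for $i=1,\dots,k$, a random right-continuous cumulative distribution function (CDF-valued random quantity) $F_i$ on $\mathbb{R}$ that is $\mathcal{A}_i$-measurable (i.e. $F_i(x)$ is $\mathcal{A}_i$-measurable for each $x\in\mathbb{R}$); a real-valued random variable $Y$ (the observation); and a random variable $V$ uniformly distributed on the unit interval and independent of $\mathcal{A}_1,\dots,\mathcal{A}_k$ and $Y$ (jointly). For a class $\mathcal{F}$ of fixed (non-random) CDFs, a combination formula is a mapping $G:\mathcal{F}^k\to\mathcal{F}$. For $k\ge2$, $G$ is coherent relative to $\mathcal{F}$ if there exists a prediction space with sub-$\sigma$-algebras $\mathcal{A}_1,\dots,\mathcal{A}_k$ and CDF-valued random quantities $F_1,\dots,F_k$ such that (C1) for $i=1,\dots,k$, $F_i=\mathcal{L}(Y\mid\mathcal{A}_i)\in\mathcal{F}$ almost surely; (C2) for $i\ne j$, $F_i\ne F_j$ with positive probability; (C3) $\mathcal{L}(Y\mid F_1,\dots,F_k)=G(F_1,\dots,F_k)$ almost surely. Here $\mathcal{L}(Y\mid\mathcal{A}_i)$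 is the conditional law of $Y$ given $\mathcal{A}_i$, identified with its CDF, and $\mathcal{L}(Y\mid F_1,\dots,F_k)$ is the conditional law of $Y$ given the $\sigma$-algebra generated by $\{F_i(x):i=1,\dots,k,\ x\in\mathbb{Q}\}$, with $\mathbb{Q}$ here denoting the rational numbers. *)

(* Defs.v *)
From HB Require Import structures.
From mathcomp Require Import all_boot all_order all_algebra.
From mathcomp Require Import all_classical all_reals all_analysis.
Set Implicit Arguments.
Unset Strict Implicit.
Unset Printing Implicit Defensive.
Import Order.TTheory GRing.Theory Num.Theory.
Import numFieldNormedType.Exports.
Local Open Scope classical_set_scope.
Local Open Scope ring_scope.

Notation CDF R := (cumulativeBounded (0 : R) (1 : R)).

(* [K] is a regular conditional distribution of Y given the sigma-algebra H.
   The type [g_sigma_algebraType H] is T equipped with <<s H >>, which is H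
   itself when H is a sigma-algebra; so the kernel K is H-measurable. *)
Definition conditional_law d (T : measurableType d) (R : realType)
    (P : probability T R) (H : set (set T)) (Y : {RV P >-> R})
    (K : R.-pker (g_sigma_algebraType H) ~> (measurableTypeR R)) : Prop :=
  forall (A : set T) (B : set R), H A -> measurable B ->
    (\int[P]_(w in A) K w B = P (A `&` Y @^-1` B))%E.

(* Almost surely, F is the CDF of L(Y | H).  Regular conditional distributions
   of a real random variable exist and are almost surely unique, so the choice
   of the version K is immaterial. *)
Definition law_CDF d (T : measurableType d) (R : realType)
    (P : probability T R) (H : set (set T)) (Y : {RV P >-> R})
    (F : T -> CDF R) : Prop :=
  exists2 K : R.-pker (g_sigma_algebraType H) ~> (measurableTypeR R),
    conditional_law Y K &
    {ae P, forall w, forall x : R, (F w x)%:E = K w `]-oo, x]%classic}.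

Record prediction_space (R : realType) (k : nat) := PredictionSpace {
  ps_display : measure_display ;
  ps_Omega : measurableType ps_display ;
  ps_Q : probability ps_Omega R ;
  ps_A : 'I_k -> set (set ps_Omega) ;
  ps_F : 'I_k -> ps_Omega -> CDF R ;
  ps_Y : {RV ps_Q >-> R} ;
  ps_V : {RV ps_Q >-> R} ;
  ps_A_sigma_algebra : forall i, sigma_algebra setT (ps_A i) ;
  ps_A_sub : forall i, ps_A i `<=` measurable ;
  ps_F_measurable : forall i (x : R),
    measurable_fun [set: g_sigma_algebraType (ps_A i)]
      (fun w => ps_F i w x) ;
  ps_V_uniform : forall B : set R, measurable B ->
    distribution ps_Q ps_V B = uniform_prob (@ltr01 R) B ;
  ps_V_independent : forall (B : set R) (E : set ps_Omega), measurable B ->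
    <<s (\bigcup_(i in [set: 'I_k]) ps_A i) `|`
        preimage_set_system setT ps_Y measurable >> E ->
    (ps_Q (ps_V @^-1` B `&` E) = ps_Q (ps_V @^-1` B) * ps_Q E)%E }.

Arguments ps_Q {R k} p.
Arguments ps_A {R k} p _.
Arguments ps_F {R k} p _ _.

Definition sigma_forecasts (R : realType) (k : nat)
    (S : prediction_space R k) : set (set (ps_Omega S)) :=
  <<s \bigcup_(i in [set: 'I_k]) \bigcup_(q in [set: rat])
        preimage_set_system setT (fun w => ps_F S i w (ratr q : R)) measurable >>.

Arguments sigma_forecasts {R k} S _.

(* A map FF^k -> FF, extended by arbitrary values to all tuples of CDFs. *)
Record combination_formula (R : realType) (k : nat) (FF : set (CDF R)) :=
  CombinationFormula {
    combine :> ('I_k -> CDF R) -> CDF R ;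
    combine_closed : forall F : 'I_k -> CDF R,
      (forall i, FF (F i)) -> FF (combine F) }.

Definition coherent (R : realType) (k : nat) (FF : set (CDF R))
    (G : combination_formula k FF) : Prop :=
  exists S : prediction_space R k,
    [/\ forall i, law_CDF (ps_A S i) (ps_Y S) (ps_F S i) /\
          {ae ps_Q S, forall w, FF (ps_F S i w)},
        forall i j, i != j ->
          (0 < ps_Q S [set w | ps_F S i w <> ps_F S j w :> (R -> R)])%E
      & law_CDF (sigma_forecasts S) (ps_Y S)
          (fun w => G (fun i => ps_F S i w))].

Definition all_CDFs (R : realType) : set (CDF R) := [set: CDF R].

(* The proofs about the weights are arguments so that the CDF structure below
   can be inferred. *)
Definition linear_pool_fun (R : realType) (k : nat) (w : 'I_k -> R)
    (w_gt0 : forall i, 0 < w i) (w_sum : \sum_i w i = 1)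
    (F : 'I_k -> CDF R) : R -> R :=
  fun x => \sum_(i < k) w i * F i x.

Section linear_pool.
Context (R : realType) (k : nat) (w : 'I_k -> R).
Context (w_gt0 : forall i, 0 < w i) (w_sum : \sum_i w i = 1).
Context (F : 'I_k -> CDF R).

Let L := linear_pool_fun w_gt0 w_sum F.

Let L_nondecreasing : nondecreasing L.
Proof.
move=> x y xy; apply: ler_sum => i _; apply: ler_wpM2l; first exact: ltW.
exact: cumulative_is_nondecreasing.
Qed.

Let L_cvg (D : set_system R) (l : 'I_k -> R) : Filter D ->
  (forall i, F i x @[x --> D] --> l i) -> L x @[x --> D] --> \sum_i w i * l i.
Proof.
move=> FD Fl; apply: cvg_big => [|i _]; first exact: add_continuous.
exact: cvgMl_tmp.
Qed.

Let L_right_continuous : right_continuous L.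
Proof.
by move=> x; apply: L_cvg => i; exact: cumulative_is_right_continuous.
Qed.

Let L_cvgNy : L @ -oo --> (0 : R).
Proof.
rewrite -[X in _ --> X](mulr0 (\sum_i w i)) mulr_suml.
by apply: L_cvg => i; exact: cumulativeNy.
Qed.

Let L_cvgy : L @ +oo --> (1 : R).
Proof.
rewrite -[X in _ --> X]w_sum -[X in _ --> X]mulr1 mulr_suml.
by apply: L_cvg => i; exact: cumulativey.
Qed.

HB.instance Definition _ :=
  isCumulative.Build R _ R (linear_pool_fun w_gt0 w_sum F)
    L_nondecreasing L_right_continuous.
HB.instance Definition _ :=
  isCumulativeBounded.Build R 0 1 (linear_pool_fun w_gt0 w_sum F)
    L_cvgNy L_cvgy.

End linear_pool.

Definition linear_pool (R : realType) (k : nat) (w : 'I_k -> R)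
    (w_gt0 : forall i, 0 < w i) (w_sum : \sum_i w i = 1) :
    combination_formula k (@all_CDFs R) :=
  @CombinationFormula R k (@all_CDFs R)
    (fun F => linear_pool_fun w_gt0 w_sum F : CDF R) (fun _ _ => I).

(* Main.v *)
Require Import Defs.
From HB Require Import structures.
From mathcomp Require Import all_boot all_order all_algebra.
From mathcomp Require Import all_classical all_reals all_analysis.
From mathcomp Require Import measurable_realfun ring.
Set Implicit Arguments.
Unset Strict Implicit.
Unset Printing Implicit Defensive.
Import Order.TTheory GRing.Theory Num.Theory.
Import HBNNSimple.
Local Open Scope ring_scope.

(** Fix a rational q, let Z be the event {Y <= q}, write p_i for the random
    variable F_i(q) and m = \sum_i w_i p_i for the pooled forecast at q.
    Calibration of F_i says that p_i = E[1_Z | A_i]; since p_i is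
    A_i-measurable, E[p_i ^ 2] = E[p_i 1_Z] (integral_mul_CDF_law).  If the
    pooled formula were coherent, the same would hold of m with respect to the
    sigma-algebra generated by the forecasts: E[m ^ 2] = E[m 1_Z].  The right
    hand sides are linear in the forecast, hence

        E[m ^ 2] = \sum_i w_i E[p_i 1_Z] = \sum_i w_i E[p_i ^ 2]

    (pool_second_moment).  The difference of the two extreme terms is the
    expectation of the weighted variance \sum_i w_i (p_i - m) ^ 2
    (weighted_variance), which is nonnegative and, all weights being positive,
    vanishes only where every p_i equals m.  So p_i = m almost surely for all i
    (ae_eq_pool).

    Letting q range over the countable set of rationals and using
    right-continuity (eq_CDF_rat), F_1 = F_2 almost surely, whereas coherence
    demands that they differ with positive probability.  Only rational q are
    used, and at those m is measurable for the sigma-algebra generated by the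
    forecasts by its very definition. *)

(** * Integration against functions measurable for a sub-sigma-algebra *)

Section sub_sigma_algebra.
Local Open Scope classical_set_scope.
Local Open Scope ereal_scope.
Context d (T : measurableType d) (R : realType).
Variables (mu : {measure set T -> \bar R}) (H : set (set T)).
Hypotheses (H_sigma : sigma_algebra setT H) (H_sub : H `<=` measurable).

Lemma g_sigma_algebra_measurable (A : set T) :
  measurable (A : set (g_sigma_algebraType H)) -> H A.
Proof. by rewrite -[X in _ -> X A](sigma_algebra_id H_sigma). Qed.

Lemma measurable_fun_sub d' (U : measurableType d') (f : T -> U) :
  measurable_fun [set: g_sigma_algebraType H] f -> measurable_fun [set: T] f.
Proof.
by move=> mf _ B mB; apply: H_sub; apply: g_sigma_algebra_measurable; exact: mf.
Qed.

(** This is the step from the defining identity of a conditional expectation,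
    which tests against the sets of H, to testing against H-measurable
    functions: it holds for simple functions by linearity, and in general by
    monotone convergence along an H-measurable approximation of g. *)
Lemma eq_integral_mul_sub (u v g : T -> R) :
  measurable_fun [set: T] u -> measurable_fun [set: T] v ->
  (forall t, (0 <= u t)%R) -> (forall t, (0 <= v t)%R) ->
  measurable_fun [set: g_sigma_algebraType H] g -> (forall t, (0 <= g t)%R) ->
  (forall A, H A -> \int[mu]_(t in A) (u t)%:E = \int[mu]_(t in A) (v t)%:E) ->
  \int[mu]_t (g t * u t)%:E = \int[mu]_t (g t * v t)%:E.
Proof.
move=> mes_u mes_v u0 v0 mg g0 uv.
have /measurable_EFinP mgE := mg.
have [h [h_nd h_cvg]] := approximation measurableT mgE (fun t _ => g0 t).
have mh n : measurable_fun [set: T] (fun t : T => h n t : R).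
  by apply: measurable_fun_sub; exact: measurable_funP.
have limE (f : T -> R) : measurable_fun [set: T] f ->
    (forall t, (0 <= f t)%R) ->
    \int[mu]_t (g t * f t)%:E = limn (fun n => \int[mu]_t (h n t * f t)%:E).
  move=> mf f0.
  rewrite -monotone_convergence//.
  - apply: eq_integral => t _; apply/esym/cvg_lim => //.
    rewrite EFinM; under eq_fun do rewrite EFinM.
    by apply: cvgeZr => //; exact: h_cvg.
  - by move=> n; apply/measurable_EFinP; exact: measurable_funM.
  - by move=> n t _; rewrite lee_fin mulr_ge0.
  - move=> t _ m n mn; rewrite lee_fin ler_wpM2r//.
    by move/lefP: (h_nd _ _ mn); apply.
rewrite (limE u)// (limE v)//; congr (limn _); apply/funext => n.
have mA r : H (h n @^-1` [set r]).
  by apply: g_sigma_algebra_measurable; exact: measurable_sfunP.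
have simpleE (f : T -> R) : measurable_fun [set: T] f ->
    (forall t, (0 <= f t)%R) ->
    \int[mu]_t (h n t * f t)%:E =
    \sum_(r \in range (h n))
      r%:E * \int[mu]_(t in h n @^-1` [set r]) (f t)%:E.
  move=> mf f0.
  have mind r : measurable_fun [set: T]
      (fun t => (\1_(h n @^-1` [set r]) t)%:E : \bar R).
    by apply/measurable_EFinP; apply: measurable_indic; exact: H_sub.
  have fE r t : (r%:E * (\1_(h n @^-1` [set r]) t)%:E) * (f t)%:E =
      r%:E * ((f t)%:E * (\1_(h n @^-1` [set r]) t)%:E).
    by rewrite -muleA; congr (_ * _); rewrite muleC.
  transitivity (\int[mu]_t \sum_(r \in range (h n))
      (r%:E * (\1_(h n @^-1` [set r]) t)%:E) * (f t)%:E).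
    apply: eq_integral => t _; rewrite EFinM fimfunE -fsumEFin//.
    by rewrite ge0_mule_fsuml// => r; exact: nnfun_muleindic_ge0.
  rewrite ge0_integral_fsum//; last 2 first.
  - move=> r; apply: emeasurable_funM; last exact/measurable_EFinP.
    exact: emeasurable_funM.
  - move=> r t _; apply: mule_ge0; first exact: nnfun_muleindic_ge0.
    by rewrite lee_fin.
  apply: eq_fsbigr => r rh.
  under eq_integral do rewrite fE.
  rewrite ge0_integralZl//.
  - congr (_ * _); rewrite [RHS]integral_mkcond.
    by apply: eq_integral => t _; rewrite epatch_indic.
  - by apply: emeasurable_funM => //; exact/measurable_EFinP.
  - by move=> t _; rewrite mule_ge0 ?lee_fin.
  - by move: rh; rewrite inE => -[t _ <-]; rewrite lee_fin.
rewrite (simpleE u)// (simpleE v)//.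
by apply: eq_fsbigr => r _; rewrite uv.
Qed.

End sub_sigma_algebra.

(** * Cumulative distribution functions *)

Section CDF_theory.
Local Open Scope classical_set_scope.
Context (R : realType).
Implicit Types F G : CDF R.

Lemma CDF_ge0 F x : 0 <= F x.
Proof.
apply: cvgr_to_le (cumulativeNy F) _; near=> y.
by apply: cumulative_is_nondecreasing; near: y; exact: nbhs_ninfty_le.
Unshelve. all: by end_near. Qed.

Lemma CDF_le1 F x : F x <= 1.
Proof.
apply: cvgr_to_ge (cumulativey F) _; near=> y.
by apply: cumulative_is_nondecreasing; near: y; exact: nbhs_pinfty_ge.
Unshelve. all: by end_near. Qed.

(** By right-continuity G x is the limit of G y for y decreasing to x, and a
    rational between x and y separates F x from G y. *)
Lemma CDF_le_rat F G : (forall q : rat, F (ratr q) <= G (ratr q)) ->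
  forall x, F x <= G x.
Proof.
move=> FG x; apply: cvgr_to_ge (cumulative_is_right_continuous G x) _.
near=> y.
have xy : x < y by near: y; exact: nbhs_right_gt.
have [q] := rat_in_itvoo xy.
rewrite in_itv/= => /andP[xq qy].
apply: le_trans (cumulative_is_nondecreasing F _ _ (ltW xq)) _.
apply: le_trans (FG q) _.
exact: cumulative_is_nondecreasing (ltW qy).
Unshelve. all: by end_near. Qed.

Lemma eq_CDF_rat F G : (forall q : rat, F (ratr q) = G (ratr q)) ->
  F = G :> (R -> R).
Proof.
move=> FG; apply/funext => x; apply/le_anti/andP.
by split; apply: CDF_le_rat => q; rewrite FG.
Qed.

End CDF_theory.

(** * Calibrated forecasts *)

Section law_CDF_theory.
Local Open Scope classical_set_scope.
Local Open Scope ereal_scope.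
Context d (T : measurableType d) (R : realType) (P : probability T R).
Variable H : set (set T).
Hypotheses (H_sigma : sigma_algebra setT H) (H_sub : H `<=` measurable).
Variables (Y : {RV P >-> R}) (F : T -> CDF R).
Hypothesis lawF : law_CDF H Y F.
Variable x : R.
Hypothesis mF : measurable_fun [set: g_sigma_algebraType H] (fun t => F t x).

Let Z := Y @^-1` `]-oo, x].

Let mZ : measurable Z.
Proof. by rewrite -[Z]setTI; exact: measurable_funP. Qed.

Lemma integral_CDF_law A : H A -> \int[P]_(t in A) (F t x)%:E = P (A `&` Z).
Proof.
move=> HA; case: lawF => K KY FK.
rewrite -(KY _ _ HA (measurable_itv _)).
apply: ge0_ae_eq_integral => //.
- exact: H_sub.
- apply: measurable_funTS; apply/measurable_EFinP.
  exact: measurable_fun_sub mF.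
- apply: measurable_funTS; apply: (measurable_fun_sub H_sigma H_sub).
  exact: measurable_kernel.
- by move=> t _; rewrite lee_fin CDF_ge0.
- by apply: filterS FK => t Ft _; exact: Ft.
Qed.

(** With g the forecast F x itself this is E[p ^ 2] = E[p 1_Z], the form in
    which calibration enters the argument. *)
Lemma integral_mul_CDF_law (g : T -> R) :
  measurable_fun [set: g_sigma_algebraType H] g -> (forall t, (0 <= g t)%R) ->
  \int[P]_t (g t * F t x)%:E = \int[P]_t (g t * \1_Z t)%:E.
Proof.
move=> mg g0; apply: (eq_integral_mul_sub H_sigma H_sub) => //.
- exact: measurable_fun_sub mF.
- by move=> t; exact: CDF_ge0.
- move=> A HA; rewrite integral_CDF_law// integral_indic//; last exact: H_sub.
  by rewrite setIC.
Qed.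

End law_CDF_theory.

(** * Weighted averages of forecast probabilities *)

Lemma weighted_variance (R : comNzRingType) (k : nat) (w p : 'I_k -> R) :
  \sum_i w i = 1 -> let m := \sum_i w i * p i in
  \sum_i w i * (p i) ^+ 2 = \sum_i w i * (p i - m) ^+ 2 + m ^+ 2.
Proof.
move=> w1 m.
have expand (c : R) : \sum_i w i * (p i - c) ^+ 2 =
    \sum_i w i * (p i) ^+ 2 - 2 * c * \sum_i w i * p i + c ^+ 2 * \sum_i w i.
  rewrite !mulr_sumr -sumrB -big_split/=.
  by apply: eq_bigr => i _; ring.
by rewrite expand w1 -/m; ring.
Qed.

(** Here p_i is a forecast probability of the event Z.  The two calibration
    hypotheses are consequences of p_i = E[1_Z | A_i] and of m being a
    conditional probability of Z; no sigma-algebra remains in this part. *)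
Section pooled_forecasts.
Local Open Scope classical_set_scope.
Local Open Scope ereal_scope.
Context d (T : measurableType d) (R : realType) (P : probability T R).
Variables (k : nat) (w : 'I_k -> R).
Hypotheses (w_gt0 : forall i, (0 < w i)%R) (w_sum : (\sum_i w i = 1)%R).
Variables (p : 'I_k -> T -> R) (Z : set T).
Hypotheses (mp : forall i, measurable_fun [set: T] (p i)) (mZ : measurable Z).
Hypothesis p_ge0 : forall i t, (0 <= p i t)%R.
Hypothesis p_le1 : forall i t, (p i t <= 1)%R.

Let m t := (\sum_i w i * p i t)%R.

Hypothesis p_calibrated : forall i,
  \int[P]_t (p i t * p i t)%:E = \int[P]_t (p i t * \1_Z t)%:E.
Hypothesis m_calibrated :
  \int[P]_t (m t * m t)%:E = \int[P]_t (m t * \1_Z t)%:E.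

Let mm : measurable_fun [set: T] m.
Proof. by apply: measurable_sum => i; exact: measurable_funM. Qed.

Let m_ge0 t : (0 <= m t)%R.
Proof. by apply: sumr_ge0 => i _; rewrite mulr_ge0// ltW. Qed.

Let m_le1 t : (m t <= 1)%R.
Proof.
rewrite -w_sum; apply: ler_sum => i _.
by rewrite ler_piMr// ltW.
Qed.

Let integral_pool (f : 'I_k -> T -> R) :
  (forall i, measurable_fun [set: T] (f i)) -> (forall i t, (0 <= f i t)%R) ->
  \int[P]_t (\sum_i w i * f i t)%:E = \sum_i (w i)%:E * \int[P]_t (f i t)%:E.
Proof.
move=> mf f0; under eq_integral do rewrite -sumEFin.
rewrite ge0_integral_sum//.
- apply: eq_bigr => i _; under eq_integral do rewrite EFinM.
  rewrite ge0_integralZl//.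
  + exact/measurable_EFinP.
  + by move=> t _; rewrite lee_fin.
  + by rewrite lee_fin ltW.
- by move=> i; apply/measurable_EFinP; exact: measurable_funM.
- by move=> i t _; rewrite lee_fin mulr_ge0// ltW.
Qed.

(** Both sides equal E[m 1_Z], because E[p 1_Z] is linear in p. *)
Lemma pool_second_moment :
  \int[P]_t (\sum_i w i * (p i t) ^+ 2)%:E = \int[P]_t ((m t) ^+ 2)%:E.
Proof.
transitivity (\int[P]_t (m t * \1_Z t)%:E); last first.
  by rewrite -m_calibrated; apply: eq_integral => t _; rewrite expr2.
transitivity (\int[P]_t (\sum_i w i * (p i t * \1_Z t))%:E); last first.
  apply: eq_integral => t _; congr EFin.
  by rewrite mulr_suml; apply: eq_bigr => i _; rewrite mulrA.
rewrite !integral_pool.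
- apply: eq_bigr => i _; congr (_ * _); rewrite -p_calibrated.
  by apply: eq_integral => t _; rewrite expr2.
- by move=> i; apply: measurable_funM => //; exact: measurable_indic.
- by move=> i t; rewrite mulr_ge0.
- by move=> i; exact: measurable_funX.
- by move=> i t; exact: sqr_ge0.
Qed.

(** By weighted_variance and pool_second_moment the weighted variance of the
    p_i around m has expectation zero. *)
Lemma ae_eq_pool : {ae P, forall t, forall i, p i t = m t}.
Proof.
pose var t := (\sum_i w i * (p i t - m t) ^+ 2)%R.
have mvar : measurable_fun [set: T] var.
  apply: measurable_sum => i; apply: measurable_funM => //.
  by apply: measurable_funX; exact: measurable_funB.
have var_ge0 t : (0 <= var t)%R.
  by apply: sumr_ge0 => i _; rewrite mulr_ge0 ?sqr_ge0// ltW.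
have m2_fin : \int[P]_t ((m t) ^+ 2)%:E \is a fin_num.
  rewrite ge0_fin_numE; last first.
    by apply: integral_ge0 => t _; rewrite lee_fin sqr_ge0.
  apply: (@le_lt_trans _ _ (\int[P]_t cst 1 t)).
    apply: ge0_le_integral => //.
    - by move=> t _; rewrite lee_fin sqr_ge0.
    - by apply/measurable_EFinP; exact: measurable_funX.
    - by move=> t _; rewrite lee_fin exprn_ile1.
  rewrite integral_cst// mul1e.
  by apply: le_lt_trans (probability_le1 P measurableT) _; rewrite ltry.
(* The second moment of m is finite, so it can be cancelled. *)
have var0 : \int[P]_t (var t)%:E = 0.
  have : \int[P]_t (var t)%:E + \int[P]_t ((m t) ^+ 2)%:E =
      0 + \int[P]_t ((m t) ^+ 2)%:E.
    rewrite add0e -[RHS]pool_second_moment -ge0_integralD//.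
    - apply: eq_integral => t _.
      by rewrite -EFinD (weighted_variance (fun i => p i t) w_sum).
    - by move=> t _; rewrite lee_fin.
    - exact/measurable_EFinP.
    - by move=> t _; rewrite lee_fin sqr_ge0.
    - by apply/measurable_EFinP; exact: measurable_funX.
  by move/(congr1 (fun z => z - \int[P]_t ((m t) ^+ 2)%:E)); rewrite !addeK.
have /(ae_eq_integral_abs P measurableT) :
    measurable_fun [set: T] (EFin \o var).
  exact/measurable_EFinP.
case=> + _ => /(_ _)[].
  rewrite -[RHS]var0; apply: eq_integral => t _.
  by rewrite gee0_abs// lee_fin.
move=> N [mN PN Nvar]; exists N; split => // t /= pm.
apply: Nvar => /= /(_ I)[] var_t; apply: pm => i.
have /psumr_eq0P/(_ var_t i isT)/eqP : forall j, true ->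
    (0 <= w j * (p j t - m t) ^+ 2)%R.
  by move=> j _; rewrite mulr_ge0 ?sqr_ge0// ltW.
by rewrite mulf_eq0 gt_eqF//= sqrf_eq0 subr_eq0 => /eqP.
Qed.

End pooled_forecasts.

(** * The linear pool is not coherent *)

Lemma ae_forall_countable d (T : measurableType d) (R : realType)
    (mu : {measure set T -> \bar R}) (I : countType) (P : I -> T -> Prop) :
  (forall i, {ae mu, forall t, P i t}) -> {ae mu, forall t, forall i, P i t}.
Proof.
move=> aeP.
have : {ae mu, forall t, forall n,
    if pickle_inv n is Some i then P i t else True}.
  by apply: ae_foralln => n; case: pickle_inv => [i|]; [exact: aeP|exact: aeW].
by apply: filterS => t Pt i; have := Pt (pickle i); rewrite pickleK_inv.
Qed.

Theorem theorem3p2 (R : realType) (k : nat) (k_ge2 : (2 <= k)%N)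
    (w : 'I_k -> R) (w_gt0 : forall i, 0 < w i) (w_sum : \sum_i w i = 1) :
  ~ @coherent R k (@all_CDFs R) (linear_pool w_gt0 w_sum).
Proof.
case=> S [C1 C2 C3].
have A_sigma i := ps_A_sigma_algebra S i.
have A_sub i := @ps_A_sub _ _ S i.
have mFT i x : measurable_fun [set: ps_Omega S] (fun t => ps_F S i t x).
  exact: (measurable_fun_sub (A_sigma i) (A_sub i) (ps_F_measurable x)).
pose G := sigma_forecasts S.
have G_sigma : sigma_algebra setT G by exact: smallest_sigma_algebra.
have G_sub : (G `<=` measurable)%classic.
  apply: smallest_sub; first exact: sigma_algebra_measurable.
  by move=> _ [i _ [q _ [B mB <-]]]; exact: mFT.
have mFG i (q : rat) : measurable_fun [set: g_sigma_algebraType G]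
    (fun t => ps_F S i t (ratr q)).
  (* Twice: G is a generated sigma-algebra, and so is the one of its type. *)
  move=> _ B mB; apply: sub_sigma_algebra; apply: sub_sigma_algebra.
  by exists i => //; exists q => //; exists B.
have mLG (q : rat) : measurable_fun [set: g_sigma_algebraType G]
    (fun t => \sum_i w i * ps_F S i t (ratr q)).
  by apply: measurable_sum => i; apply: measurable_funM.
have L_ge0 (q : rat) t : 0 <= \sum_i w i * ps_F S i t (ratr q).
  by apply: sumr_ge0 => i _; rewrite mulr_ge0 ?CDF_ge0// ltW.
have F_eq (q : rat) : {ae ps_Q S, forall t i,
    ps_F S i t (ratr q) = \sum_j w j * ps_F S j t (ratr q)}.
  apply: (@ae_eq_pool _ _ _ (ps_Q S) k w w_gt0 w_sum
    (fun i t => ps_F S i t (ratr q)) (ps_Y S @^-1` `]-oo, (ratr q)]%classic)).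
  - by move=> i; exact: mFT.
  - by rewrite -[X in measurable X]setTI; exact: measurable_funP.
  - by move=> i t; exact: CDF_ge0.
  - by move=> i t; exact: CDF_le1.
  - move=> i; have [lawF _] := C1 i.
    apply: (integral_mul_CDF_law (A_sigma i) (A_sub i) lawF).
    + exact: ps_F_measurable.
    + exact: ps_F_measurable.
    + by move=> t; exact: CDF_ge0.
  - exact: (integral_mul_CDF_law G_sigma G_sub C3 (mLG q) (mLG q) (L_ge0 q)).
pose i0 : 'I_k := Ordinal (ltnW k_ge2); pose i1 : 'I_k := Ordinal k_ge2.
have := C2 i0 i1 isT; rewrite lt0e => /andP[/eqP + _]; apply.
(* A countable union over the rationals, the disagreement set is measurable,
   so that it is enough to include it in a null set. *)
apply: measure_negligible.
  have -> : [set t | ps_F S i0 t <> ps_F S i1 t :> (R -> R)]%classic =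
      (\bigcup_(q in [set: rat]) (setT `&`
        [set t | (ps_F S i0 t (ratr q))%:E != (ps_F S i1 t (ratr q))%:E]))%classic.
    apply/seteqP; split => t /=.
      move=> F01; apply: contrapT => Fq; apply: F01; apply: eq_CDF_rat => q.
      apply: contrapT => Fq01; apply: Fq; exists q => //; split => //.
      by apply/eqP => -[].
    by case=> q _ [_ /= /eqP Fq] F01; apply: Fq; rewrite F01.
  apply: countable_bigcupT_measurable => // q.
  by apply: measurable_neqe => //; apply/measurable_EFinP; exact: mFT.
have [N [mN N0 DN]] := ae_forall_countable F_eq.
exists N; split => // t F01; apply: DN => /= Fq; apply: F01.
by apply: eq_CDF_rat => q; rewrite (Fq q i0) (Fq q i1).
Qed.
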